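(* Let $L=\{F\}$ be the first-order language with one unary function symbol $F$. The property $\phi(x):=(F(x)\neq x)$ is regular.
   Context: $\mathbf{S}_n(L)$ is the set of $L$-structures $\mathcal{M}=\langle M,f\rangle$ with $M=\{1,\ldots,n\}$ and $f:M\to M$. For a first-order formula $\phi(x)$ of $L$ with one free variable and without parameters, $\phi(\mathcal{M})=\{a\in M:\mathcal{M}\models\phi(a)\}$. Let $\mathbf{S}_{2n}(\phi:\mathrm{ntr})=\{\mathcal{M}\in\mathbf{S}_{2n}(L):|\phi(\mathcal{M})|=n\}$, $d_{2n}(\phi:\mathrm{ntr})=|\mathbf{S}_{2n}(\phi:\mathrm{ntr})|/|\mathbf{S}_{2n}(L)|$, and $d(\phi:\mathrm{ntr})=\lim_{n\to\infty}d_{2n}(\phi:\mathrm{ntr})$ whenever this limit exists. The property $\phi(x)$ is regular if $d(\phi:\mathrm{ntr})=0$. *)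

(* Defs.v *)
From HB Require Import structures.
From mathcomp Require Import all_boot all_order all_algebra.
From mathcomp Require Import all_classical all_reals all_analysis.

Set Implicit Arguments.
Unset Strict Implicit.
Unset Printing Implicit Defensive.

Import Order.TTheory GRing.Theory Num.Theory.
Import numFieldNormedType.Exports.
Local Open Scope classical_set_scope.
Local Open Scope ring_scope.

(* First-order syntax (with equality) over the language {F}, F a unary        *)
(* function symbol. [term k] and [formula k] have their free variables among  *)
(* 'I_k, so a parameter-free formula phi(x) is an element of [formula 1].     *)
Inductive term (k : nat) : Type :=
| Var of 'I_k
| App of term k.

(* De Bruijn indices: a quantifier binds variable 0 of its body. *)
Inductive formula : nat -> Type :=
| Bot k : formula k
| Eq k of term k & term k : formula k
| Not k of formula k : formula k
| And k of formula k & formula k : formula k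
| Or k of formula k & formula k : formula k
| Imp k of formula k & formula k : formula k
| All k of formula k.+1 : formula k
| Ex k of formula k.+1 : formula k.

Definition scons (M : Type) (k : nat) (a : M) (e : 'I_k -> M) : 'I_k.+1 -> M :=
  fun i => if unlift ord0 i is Some j then e j else a.

Fixpoint eval (M : Type) (f : M -> M) (k : nat) (e : 'I_k -> M) (t : term k) : M :=
  match t with
  | Var i => e i
  | App s => f (eval f e s)
  end.

(* Tarskian satisfaction; it is boolean because the universe M is finite. *)
Fixpoint sat (M : finType) (f : M -> M) (k : nat) (phi : formula k) :
    ('I_k -> M) -> bool :=
  match phi in formula k return ('I_k -> M) -> bool with
  | Bot _ => fun=> false
  | Eq _ s t => fun e => eval f e s == eval f e t
  | Not _ p => fun e => ~~ sat f p e
  | And _ p q => fun e => sat f p e && sat f q e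
  | Or _ p q => fun e => sat f p e || sat f q e
  | Imp _ p q => fun e => sat f p e ==> sat f q e
  | All _ p => fun e => [forall a, sat f p (scons a e)]
  | Ex _ p => fun e => [exists a, sat f p (scons a e)]
  end.

(* S_n(L): the universe {1, ..., n} is encoded as 'I_n, and a structure is    *)
(* given by its interpretation of F.                                          *)
Definition structures (n : nat) : finType := {ffun 'I_n -> 'I_n}.

Definition defset (n : nat) (phi : formula 1) (f : structures n) : {set 'I_n} :=
  [set a | sat f phi (fun=> a)]%SET.

Definition structures_ntr (phi : formula 1) (n : nat) :
    {set structures (2 * n)%N} :=
  [set f : structures (2 * n)%N | #|defset phi f| == n]%SET.

Definition d2n (R : realType) (phi : formula 1) (n : nat) : R :=
  #|structures_ntr phi n|%:R / #|structures (2 * n)%N|%:R.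

(* d(phi : ntr) exists and equals d. *)
Definition is_density_ntr (R : realType) (phi : formula 1) (d : R) : Prop :=
  d2n R phi n @[n --> \oo] --> d.

Definition regular (R : realType) (phi : formula 1) : Prop :=
  is_density_ntr phi (0 : R).

Definition phi_nonfixed : formula 1 :=
  Not (Eq (App (Var ord0)) (Var ord0)).

(* Main.v *)
Require Import Defs.
From mathcomp Require Import all_boot all_order all_algebra.
From mathcomp Require Import all_classical all_reals all_analysis.

(** A random map of an m-element set has one fixed point on average, so by
    Markov's inequality a map of a 2n-element set has exactly n fixed points
    with probability at most 1/n. *)

Set Implicit Arguments.
Unset Strict Implicit.
Unset Printing Implicit Defensive.

Import Order.TTheory GRing.Theory Num.Theory.
Import numFieldNormedType.Exports.

(** Double counting of the pairs [(f, a)] with [f a = a] ([sum_card_fixed]) gives the average of one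
    fixed point. Exactly half of the points are moved iff exactly half are fixed, so
    [card_structures_ntr_nonfixed] bounds the density by 1/n, which tends to 0. *)

Lemma card_fixing (T : finType) (a : T) :
  #|[set f : {ffun T -> T} | f a == a]%SET| = (#|T| ^ #|T|.-1)%N.
Proof.
(* The value at [a] is forced and the others are free, so these maps form a product family. *)
pose F x : pred T := if x == a then pred1 a else predT.
rewrite (_ : #|_| = #|family F|); last first.
  apply: eq_card => f; rewrite inE; apply/eqP/familyP => [fa x|/(_ a)].
    by rewrite /F; case: eqVneq => [->|_]; rewrite inE // fa.
  by rewrite /F eqxx inE => /eqP.
rewrite card_family foldrE big_map big_enum /= (bigD1 a) //= /F eqxx card1 mul1n.
rewrite (eq_bigr (fun=> #|T|)) => [|x /negPf ->]; last exact: eq_card.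
by rewrite prod_nat_const cardC1.
Qed.

(** Exchange the two sums. Keeping the factor [#|T|] apart makes the formula valid for empty [T]
    too, where [#|T| ^ #|T|] would be 1. *)
Lemma sum_card_fixed (T : finType) :
  (\sum_(f : {ffun T -> T}) #|[set a | f a == a]%SET| = #|T| * #|T| ^ #|T|.-1)%N.
Proof.
under eq_bigr => f _ do rewrite -sum1dep_card big_mkcond.
rewrite exchange_big -sum_nat_const; apply: eq_bigr => a _.
by rewrite -(card_fixing a) -sum1dep_card [RHS]big_mkcond.
Qed.

(** Markov's inequality, cleared of denominators. *)
Lemma card_structures_ntr_nonfixed n :
  (n * #|structures_ntr phi_nonfixed n| <= #|structures (2 * n)|)%N.
Proof.
case: n => [//|n].
rewrite card_ffun card_ord -[X in (_ <= X ^ X)%N]card_ord.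
rewrite -[X in (_ <= _ ^ X)%N]prednK ?card_ord // expnS.
have := sum_card_fixed 'I_(2 * n.+1); rewrite card_ord => <-.
(* Termwise comparison: each structure counted on the left contributes its number of fixed points,
   the others contribute 0. *)
rewrite mulnC -sum_nat_const big_mkcond; apply: leq_sum => f _.
rewrite inE; case: eqP => // card_f.
rewrite (_ : [set a | f a == a]%SET = ~: defset phi_nonfixed f)%SET.
  by rewrite cardsCs finset.setCK card_f card_ord mul2n -addnn addnK.
by apply/setP => a; rewrite !inE negbK.
Qed.

Theorem proposition5p2 (R : realType) : regular R phi_nonfixed.
Proof.
(* The shift to [n.+1] avoids n = 0 and turns the bound 1/n into the harmonic sequence. *)
rewrite /regular /is_density_ntr -cvg_shiftS /=.
apply: (squeeze_cvgr _ (cvg_cst _) (@cvg_harmonic R)).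
apply: nearW => n; rewrite /d2n divr_ge0 ?ler0n //=.
have card_gt0 : (0 < #|structures (2 * n.+1)|)%N.
  by rewrite card_ffun card_ord expn_gt0.
rewrite ler_pdivrMr ?ltr0n // ler_pdivlMl ?ltr0n //.
by rewrite -natrM ler_nat card_structures_ntr_nonfixed.
Qed.
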